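(* Let $R^*:=\bigcap_{R\in\mathcal E,\ R\text{ closed}}R$. If $R^*$ is an optimal equilibrium and $(R^* )^c=C_{R^*}$ (complement in $\mathbb X$), then $R^*$ is the unique closed optimal equilibrium.
   Context: $X=(X_t)_{t\ge 0}$ is a time-homogeneous continuous strong Markov process on a probability space $(\Omega,\mathcal F,\mathbb P)$, taking values in an interval $\mathbb X\subseteq\mathbb R$. $\mathcal B(\mathbb X)$ is the collection of Borel subsets of $\mathbb X$; $\mathbb P^x,\mathbb E^x$ denote probability and expectation given $X_0=x$, and $X^x$ denotes $X$ started at $x\in\mathbb X$. The payoff function $f:\mathbb X\to[0,\infty)$ is continuous. The discount function $\delta:[0,\infty)\to(0,1]$ is non-increasing and continuous, with $\delta(0)=1$, $\delta(t)\to0$ as $t\to\infty$, and is log sub-additive: $\delta(s)\delta(t)\le\delta(s+t)$ for all $s,t>0$. For $x\in\mathbb X$, $R\in\mathcal B(\mathbb X)$: $\rho(x,R):=\inf\{t>0: X^x_t\in R\}$ ($\inf\emptyset=\infty$) and $J(x,R):=\mathbb E^x[\delta(\rho(x,R))f(X_{\rho(x,R)})]$, where on $\{\rho(x,R)=\infty\}$ the integrand is taken to be $\limsup_{t\to\infty}\delta(t)f(X^x_t)$. Put $S_R:=\{x: f(x)>J(x,R)\}$, $I_R:=\{x: f(x)=J(x,R)\}$, $C_R:=\{x: f(x)<J(x,R)\}$, and $\Theta(R):=S_R\cup(I_R\cap R)$. $R\in\mathcal B(\mathbb X)$ is an equilibrium if $\Theta(R)=R$; $\mathcal E$ is the set of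 all equilibria. $V(x,R):=\max\{f(x),J(x,R)\}$. $\hat R\in\mathcal E$ is an optimal equilibrium if $V(x,\hat R)\ge V(x,R)$ for all $x\in\mathbb X$ and all $R\in\mathcal E$. ''Closed'' means closed relative to $\mathbb X$. *)

(* Defs.v *)
From HB Require Import structures.
From mathcomp Require Import all_boot all_order all_algebra.
From mathcomp Require Import all_classical all_reals all_analysis measurable_realfun.

Set Implicit Arguments.
Unset Strict Implicit.
Unset Printing Implicit Defensive.

Import Order.TTheory GRing.Theory Num.Theory.
Import numFieldNormedType.Exports.

Local Open Scope classical_set_scope.
Local Open Scope ring_scope.
Local Open Scope ereal_scope.

(* The state space is a set [XX] of reals (an interval), and time ranges over
   the nonnegative reals. Processes are total functions [X : R -> T -> R] read
   only at nonnegative times, and laws are indexed by all reals but read only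
   on [XX]. *)

Section Filtration.
Context d (T : measurableType d) (R : realType).

Record filtration (G : R -> set (set T)) : Prop := Filtration {
  filtration_sigma : forall t : R, (0 <= t)%R -> sigma_algebra setT (G t) ;
  filtration_sub : forall t : R, (0 <= t)%R -> G t `<=` measurable ;
  filtration_mono : forall s t : R, (0 <= s)%R -> (s <= t)%R -> G s `<=` G t }.

Definition adapted (G : R -> set (set T)) (X : R -> T -> R) : Prop :=
  forall t : R, (0 <= t)%R ->
  forall B : set R, measurable B -> G t (X t @^-1` B).

Definition stopping_time (G : R -> set (set T)) (tau : T -> \bar R) : Prop :=
  (forall w, 0 <= tau w) /\
  (forall t : R, (0 <= t)%R -> G t [set w | tau w <= t%:E]).

Definition stopped_sigma_algebra (G : R -> set (set T)) (tau : T -> \bar R)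
    : set (set T) :=
  [set A | measurable A /\
    forall t : R, (0 <= t)%R -> G t (A `&` [set w | tau w <= t%:E])].

Definition path_sigma_algebra (X : R -> T -> R) : set (set T) :=
  <<s [set A | exists t : R, exists2 B : set R,
         (0 <= t)%R /\ measurable B & A = X t @^-1` B] >>.

End Filtration.

Section StrongMarkov.
Context d (T : measurableType d) (R : realType).

(* [P0] is the underlying probability and [P x] the probability given
   [X 0 = x]: the family [P] is a regular conditional distribution, given
   [X 0], of the path of [X] under [P0]. The kernel in [smp_strong_markov] does
   not depend on the date, which is time-homogeneity. The filtration is a
   parameter, so that both the raw filtration of [X] and its enlargements are
   covered. *)
Record strong_markov_process (XX : set R) (G : R -> set (set T))
    (X : R -> T -> R) (P0 : probability T R) (P : R -> probability T R)
    : Prop := StrongMarkovProcess {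
  smp_filtration : filtration G ;
  smp_adapted : adapted G X ;
  smp_state : forall (t : R) (w : T), (0 <= t)%R -> XX (X t w) ;
  smp_continuous :
    forall w, {within `[0%R, +oo[, continuous (fun t => X t w)} ;
  smp_start : forall x : R, XX x -> P x [set w | X 0%R w = x] = 1 ;
  smp_kernel : forall (t : R) (B : set R), (0 <= t)%R -> measurable B ->
    measurable_fun XX (fun x : R => P x (X t @^-1` B)) ;
  smp_conditional : forall (A : set T) (B : set R),
    path_sigma_algebra X A -> measurable B ->
    P0 (A `&` X 0%R @^-1` B) =
      \int[P0]_(w in X 0%R @^-1` B) P (X 0%R w) A ;
  smp_strong_markov : forall x : R, XX x ->
    forall tau : T -> \bar R, stopping_time G tau ->
    forall A, stopped_sigma_algebra G tau A ->
    forall (t : R) (B : set R), (0 <= t)%R -> measurable B ->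
    P x (A `&` [set w | tau w < +oo /\ B (X (fine (tau w) + t)%R w)]) =
      \int[P x]_(w in A `&` [set w | tau w < +oo])
         P (X (fine (tau w)) w) (X t @^-1` B) }.

End StrongMarkov.

Record discount_function (R : realType) (delta : R -> R) : Prop :=
  DiscountFunction {
  discount_range : forall t : R, (0 <= t)%R -> (0 < delta t <= 1)%R ;
  discount_nonincreasing :
    forall s t : R, (0 <= s)%R -> (s <= t)%R -> (delta t <= delta s)%R ;
  discount_continuous : {within `[0%R, +oo[, continuous delta} ;
  discount0 : delta 0%R = 1%R ;
  discount_cvg : delta t @[t --> +oo%R] --> 0%R ;
  discount_log_subadditive : forall s t : R, (0 < s)%R -> (0 < t)%R ->
    (delta s * delta t <= delta (s + t))%R }.

Record payoff_function (R : realType) (XX : set R) (f : R -> R) : Prop :=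
  PayoffFunction {
  payoff_ge0 : forall x : R, XX x -> (0 <= f x)%R ;
  payoff_continuous : {within XX, continuous f} }.

Section Equilibrium.
Context d (T : measurableType d) (R : realType).
Variables (XX : set R) (X : R -> T -> R) (P : R -> probability T R).
Variables (delta f : R -> R).

Definition hitting_time (A : set R) (w : T) : \bar R :=
  ereal_inf [set t%:E | t in [set t | (0 < t)%R /\ A (X t w)]].

Definition stopped_payoff (A : set R) (w : T) : \bar R :=
  if hitting_time A w is t%:E then (delta t * f (X t w))%:E
  else limf_esup (fun t => (delta t * f (X t w))%:E) (pinfty_nbhs R).

(* [stopped_payoff A] need only be measurable for the [P x]-completion when [A]
   is an arbitrary Borel set. Being nonnegative, it is integrated below by the
   supremum of the integrals of the measurable simple functions it dominates,
   which is its integral with respect to the completion. *)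
Definition J (x : R) (A : set R) : \bar R := \int[P x]_w stopped_payoff A w.

Definition stop_set (A : set R) : set R :=
  [set x | XX x /\ J x A < (f x)%:E].

Definition indiff_set (A : set R) : set R :=
  [set x | XX x /\ (f x)%:E = J x A].

Definition cont_set (A : set R) : set R :=
  [set x | XX x /\ (f x)%:E < J x A].

Definition Theta (A : set R) : set R := stop_set A `|` (indiff_set A `&` A).

(* As [XX] is Borel, its Borel subsets are the Borel sets of reals included
   in [XX]. *)
Definition equilibrium (A : set R) : Prop :=
  [/\ measurable A, A `<=` XX & Theta A = A].

Definition V (x : R) (A : set R) : \bar R := maxe (f x)%:E (J x A).

Definition optimal_equilibrium (A : set R) : Prop :=
  equilibrium A /\
  forall x : R, XX x -> forall B, equilibrium B -> V x B <= V x A.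

Definition closed_in (A : set R) : Prop := closed (A : set (subspace XX)).

(* Membership in [XX] makes the empty intersection equal to [XX]. *)
Definition Rstar : set R :=
  XX `&` \bigcap_(A in [set A | equilibrium A /\ closed_in A]) A.

End Equilibrium.

(* Main.v *)
Require Import Defs.
From HB Require Import structures.
From mathcomp Require Import all_boot all_order all_algebra.
From mathcomp Require Import all_classical all_reals all_analysis measurable_realfun.

Local Open Scope classical_set_scope.
Local Open Scope ring_scope.

Import Order.TTheory.

(** A closed optimal equilibrium [A] contains [Rstar] by definition of the intersection. At a point
    of [A] outside [Rstar], the value of [A] is just [f], while [hC] makes that of [Rstar] strictly
    larger, which contradicts the optimality of [A]. *)

Theorem theorem5p1 (d : measure_display) (T : measurableType d) (R : realType)
    (XX : set R) (G : R -> set (set T)) (X : R -> T -> R)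
    (P0 : probability T R) (P : R -> probability T R) (delta f : R -> R)
    (hXX : is_interval XX)
    (hX : strong_markov_process XX G X P0 P)
    (hdelta : discount_function delta)
    (hf : payoff_function XX f)
    (hopt : optimal_equilibrium XX X P delta f (Rstar XX X P delta f))
    (hC : XX `\` Rstar XX X P delta f
          = cont_set XX X P delta f (Rstar XX X P delta f)) :
  unique (fun A : set R => closed_in XX A /\
                           optimal_equilibrium XX X P delta f A)
         (Rstar XX X P delta f).
Proof.
split.
  (* Closedness is relative: [XX] itself may fail to be closed in the reals. *)
  split=> //; apply: closedI; first exact: closed_subspaceT.
  by apply: closed_bigI => A [].
move=> A [Acl [Aeq Aopt]]; have [_ subA ThetaA] := Aeq.
rewrite eqEsubset; split=> x; first by case=> _; apply.
move=> Ax; have XXx := subA _ Ax.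
have JA : (J X P delta f x A <= (f x)%:E)%E.
  by move: Ax; rewrite -{1}ThetaA => -[[_ /ltW]|[[_ ->]]].
apply: contrapT => nRx.
have : (XX `\` Rstar XX X P delta f) x by [].
(* Outside [Rstar] continuing is strictly better than stopping, whereas an
   equilibrium earns only [f] on its own points. *)
rewrite hC => -[_]; apply/negP; rewrite -leNgt.
(* Optimality of [A] is tested against [Rstar]; by [JA], [V x A] collapses to [f x]. *)
have := Aopt x XXx _ (proj1 hopt).
by rewrite {2}/V (max_idPl JA) => /(le_trans _); apply; rewrite le_max lexx orbT.
Qed.
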